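(* Let $(\mathcal Z,\mathfrak S)$ be a normalised hierarchically hyperbolic space with wedges and clean containers. Then each of the following properties implies the lower ones, meaning that if $(\mathcal Z,\mathfrak S)$ has some property $(i)$ from the list, and $j>i$, then there exists a normalised HHS structure $(\mathcal Z,\mathfrak S')$, with $\mathfrak S\subset\mathfrak S'$ and satisfying wedges, clean containers and property $(j)$: (1) the strong orthogonal property; (2) the weak orthogonal property; (3) the weak orthogonal property and dense product regions; (4) orthogonals for non-split domains and bounded split coordinate spaces; (5) orthogonals for non-split domains and dense product regions.
   Context: HIERARCHICALLY HYPERBOLIC SPACES. The distance between two subsets is the infimum of distances between their points; $d_U(x,y)$ means $d_U(\pi_U(x),\pi_U(y))$ for $x,y\in\mathcal Z$, and $d_U(x,p)$ means $d_U(\pi_U(x),p)$. A $q$-quasigeodesic metric space $(\mathcal Z,d_{\mathcal Z})$ is a hierarchically hyperbolic space (HHS) $(\mathcal Z,\mathfrak S)$ if there are $E\ge 0$ (the HHS constant), an index set $\mathfrak S$ (elements are called domains) and $E$-hyperbolic spaces $(\mathcal CU,d_U)$, $U\in\mathfrak S$ (coordinate spaces), such that the following hold (these data form an HHS structure on $\mathcal Z$): (1) Projections: for each $U$ there is $\pi_U:\mathcal Z\to 2^{\mathcal CU}$ sending points to sets of diameter at most $E$; $\pi_U$ is $(E,E)$-coarsely Lipschitz and $\pi_U(\mathcal Z)$ is $E$-quasiconvex. (2) Nesting: $\mathfrak S$ has a partial order $\sqsubseteq$ (strict version $\sqsubset$), and either $\mathfrak S=\emptyset$ or there is a unique $\sqsubseteq$-maximal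 element $S$. Let $\mathfrak S_U=\{V: V\sqsubseteq U\}$. If $V\sqsubset U$ there are a specified subset $\rho^V_U\subset\mathcal CU$ of diameter at most $E$ and a map $\rho^U_V:\mathcal CU\to 2^{\mathcal CV}$. (3) Orthogonality: $\mathfrak S$ has a symmetric anti-reflexive relation $\perp$; if $V\sqsubseteq U$ and $U\perp W$ then $V\perp W$; for each $T$ and $U\in\mathfrak S_T$ with $\{V\in\mathfrak S_T:V\perp U\}\ne\emptyset$ there is $W\in\mathfrak S_T\setminus\{T\}$ (a container) such that $V\sqsubseteq W$ whenever $V\perp U$, $V\sqsubseteq T$; orthogonal domains are not $\sqsubseteq$-comparable. (4) Transversality and consistency: if $U,V$ are neither orthogonal nor $\sqsubseteq$-comparable they are transverse, $U\pitchfork V$, and there are sets $\rho^V_U\subseteq\mathcal CU$, $\rho^U_V\subseteq\mathcal CV$ of diameter at most $E$ with $\min\{d_U(z,\rho^V_U),d_V(z,\rho^U_V)\}\le E$ for all $z\in\mathcal Z$. If $V\sqsubset U$ then $\min\{d_U(z,\rho^V_U),\mathrm{diam}_{\mathcal CV}(\pi_V(z)\cup\rho^U_V(\pi_U(z)))\}\le E$ for all $z$. If $U\sqsubseteq V$, then $d_W(\rho^U_W,\rho^V_W)\le E$ whenever $V\sqsubset W$, or $V\pitchfork W$ and $W\not\perp U$. (5) Finite complexity: there is $n$ (the complexity being the least such) bounding the cardinality of any set of pairwise $\sqsubseteq$-comparable elements. (6) Large links: for $U\in\mathfrak S$, $z,z'\in\mathcal Z$ and $N=d_U(z,z')$ there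 are $T_1,\dots,T_{\lfloor N\rfloor}\in\mathfrak S_U\setminus\{U\}$ such that every $T\in\mathfrak S_U\setminus\{U\}$ either is nested in some $T_i$ or satisfies $d_T(z,z')<E$; also $d_U(z,\rho^{T_i}_U)\le N$ for each $i$. (7) Bounded geodesic image: if $V\sqsubset U$ and $\gamma$ is a geodesic of $\mathcal CU$, then $\mathrm{diam}(\rho^U_V(\gamma))\le E$ or $\gamma$ meets the $E$-neighbourhood of $\rho^V_U$. (8) Partial realisation: if $\{V_j\}$ are pairwise orthogonal and $p_j\in\pi_{V_j}(\mathcal Z)$, there is $z\in\mathcal Z$ with $d_{V_j}(z,p_j)\le E$ for all $j$ and $d_V(z,\rho^{V_j}_V)\le E$ for all $j$ and all $V$ with $V_j\sqsubset V$ or $V_j\pitchfork V$. (9) Uniqueness: for each $\kappa\ge0$ there is $\theta_u(\kappa)$ such that $d_{\mathcal Z}(x,y)\ge\theta_u$ implies $d_V(x,y)\ge\kappa$ for some $V\in\mathfrak S$. The structure is normalised if the maps $\pi_U$ are coarsely surjective with constants uniform in $U$. PROPERTIES. Wedges: for all $U,V\in\mathfrak S$, either no $T\in\mathfrak S$ is nested in both, or there is a unique $\sqsubseteq$-maximal $T\in\mathfrak S$ nested in both (every domain nested in both is nested in $T$). Clean containers: whenever $U\sqsubset T$ and $A=\{V\in\mathfrak S: V\sqsubset T, V\perp U\}\neq\emptyset$, there is $U^\perp_T\sqsubset T$ with $U^\perp_T\perp U$ and $V\sqsubseteq U^\perp_T$ for all $V\in A$. Strong orthogonal property: whenever $U\sqsubset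 V$ there is $W\sqsubset V$ with $U\perp W$. Weak orthogonal property: whenever $U\sqsubset V$ and $U$ is not $\sqsubseteq$-minimal, there is $W\sqsubset V$ with $U\perp W$. A domain $U$ is split if there is a $\sqsubseteq$-minimal domain $W\sqsubseteq U$ such that every $V\sqsubseteq U$ satisfies $W\sqsubseteq V$ or $W\perp V$. Orthogonals for non-split domains: whenever $U\sqsubset V$, either $U$ is split or there is $W\sqsubset V$ with $W\perp U$. Dense product regions (DPR): there is a constant $M_0$ such that for every non-$\sqsubseteq$-minimal $U\in\mathfrak S$ and every $p\in\mathcal CU$ there is $V\sqsubset U$ with $d_U(p,\rho^V_U)\le M_0$. Bounded split coordinate spaces: there is $c\ge0$ such that for every $U\in\mathfrak S\setminus\{S\}$ which is split and not $\sqsubseteq$-minimal, $\mathcal CU$ has diameter at most $c$. *)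

(* Defs.v *)
From mathcomp Require Import all_boot all_order all_algebra.
From mathcomp Require Import all_classical all_reals all_analysis.

Set Implicit Arguments.
Unset Strict Implicit.
Unset Printing Implicit Defensive.

Import Order.TTheory GRing.Theory Num.Theory.

Local Open Scope classical_set_scope.
Local Open Scope ring_scope.
Local Open Scope card_scope.
Local Open Scope ereal_scope.

(* Distances between sets and diameters are extended reals: the distance to
   the empty set is +oo and the diameter of the empty set is -oo. *)
Definition setdist (R : realType) (X : metricType R) (A B : set X) : \bar R :=
  ereal_inf [set (mdist a b)%:E | a in A & b in B].

Definition ediam (R : realType) (X : metricType R) (A : set X) : \bar R :=
  ereal_sup [set (mdist a b)%:E | a in A & b in A].

Definition neighbourhood (R : realType) (X : metricType R) (E : R) (A : set X) :
    set X :=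
  [set x | setdist [set x] A <= E%:E].

(* g is the image of a geodesic segment from x to y *)
Definition geodesic (R : realType) (X : metricType R) (x y : X) (g : set X) :
    Prop :=
  exists (L : R) (f : R -> X),
    [/\ (0 <= L)%R, f 0%R = x, f L = y,
        (forall s t : R, s \in `[0%R, L] -> t \in `[0%R, L] ->
           mdist (f s) (f t) = `|s - t|%R)
      & g = f @` `[0%R, L]].

Definition hyperbolic (R : realType) (E : R) (X : metricType R) : Prop :=
  (forall x y : X, exists g, geodesic x y g) /\
  (forall (x y z : X) (a b c : set X),
     geodesic x y a -> geodesic y z b -> geodesic x z c ->
     c `<=` neighbourhood E (a `|` b)).

Definition quasiconvex (R : realType) (X : metricType R) (E : R) (A : set X) :
    Prop :=
  forall x y g, A x -> A y -> geodesic x y g -> g `<=` neighbourhood E A.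

Definition quasigeodesic_space (R : realType) (q : R) (X : metricType R) :
    Prop :=
  (1 <= q)%R /\
  forall x y : X, exists (L : R) (f : R -> X),
    [/\ (0 <= L)%R, f 0%R = x, f L = y
      & forall s t : R, s \in `[0%R, L] -> t \in `[0%R, L] ->
          (q^-1 * `|s - t| - q <= mdist (f s) (f t) <= q * `|s - t| + q)%R].

(* [rho V U : set (coord_space U)] is the set $\rho^V_U$, meaningful when V is
   properly nested in, or transverse to, U.  [rhomap U V] is the map
   $\rho^U_V : CU \to 2^{CV}$, meaningful when V is properly nested in U.
   Outside these cases their values are unconstrained. *)
Record hhs_data (R : realType) (Z : metricType R) := HHSData {
  domain : Type ;
  coord_space : domain -> metricType R ;
  coord_proj : forall U : domain, Z -> set (coord_space U) ;
  nest : domain -> domain -> Prop ;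
  orth : domain -> domain -> Prop ;
  rho : forall V U : domain, set (coord_space U) ;
  rhomap : forall U V : domain, coord_space U -> set (coord_space V)
}.

Arguments coord_proj {R Z h} U z.
Arguments rho {R Z h} V U.
Arguments rhomap {R Z h U} V p.

Definition pnest (R : realType) (Z : metricType R) (D : hhs_data Z)
    (U V : domain D) : Prop :=
  nest U V /\ U <> V.

Definition transverse (R : realType) (Z : metricType R) (D : hhs_data Z)
    (U V : domain D) : Prop :=
  [/\ ~ orth U V, ~ nest U V & ~ nest V U].

Definition nest_minimal (R : realType) (Z : metricType R) (D : hhs_data Z)
    (U : domain D) : Prop :=
  forall V : domain D, nest V U -> V = U.

Definition nest_maximal (R : realType) (Z : metricType R) (D : hhs_data Z)
    (U : domain D) : Prop :=
  forall V : domain D, nest U V -> V = U.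

Definition proj_image (R : realType) (Z : metricType R) (D : hhs_data Z)
    (U : domain D) : set (coord_space U) :=
  \bigcup_(z in [set: Z]) coord_proj U z.

Arguments proj_image {R Z D} U.

Definition rhomap_image (R : realType) (Z : metricType R) (D : hhs_data Z)
    (U V : domain D) (A : set (coord_space U)) : set (coord_space V) :=
  \bigcup_(p in A) rhomap V p.

Arguments rhomap_image {R Z D U} V A.

(* Coarse points and coarse maps are understood to be nonempty(-valued). *)
Record hhs_axioms (R : realType) (Z : metricType R) (D : hhs_data Z) (E : R) :
    Prop := HHSAxioms {
  coord_hyperbolic : forall U : domain D, hyperbolic E (coord_space U) ;

  proj_nonempty : forall (U : domain D) (z : Z), coord_proj U z !=set0 ;
  proj_diam : forall (U : domain D) (z : Z), ediam (coord_proj U z) <= E%:E ;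
  proj_lipschitz : forall (U : domain D) (x y : Z),
    setdist (coord_proj U x) (coord_proj U y) <= (E * mdist x y + E)%:E ;
  proj_quasiconvex : forall U : domain D, quasiconvex E (proj_image U) ;

  nest_refl : forall U : domain D, nest U U ;
  nest_antisym : forall U V : domain D, nest U V -> nest V U -> U = V ;
  nest_trans : forall U V W : domain D, nest U V -> nest V W -> nest U W ;
  nest_top : (domain D -> False) \/ exists! S : domain D, nest_maximal S ;
  pnest_rho : forall U V : domain D, pnest V U ->
    rho V U !=set0 /\ ediam (rho V U) <= E%:E ;
  pnest_rhomap : forall (U V : domain D) (p : coord_space U), pnest V U ->
    rhomap V p !=set0 ;

  orth_sym : forall U V : domain D, orth U V -> orth V U ;
  orth_irrefl : forall U : domain D, ~ orth U U ;
  orth_nest : forall U V W : domain D, nest V U -> orth U W -> orth V W ;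
  orth_container : forall T U : domain D, nest U T ->
    (exists2 V, nest V T & orth V U) ->
    exists2 W, pnest W T & forall V, orth V U -> nest V T -> nest V W ;
  orth_incomparable : forall U V : domain D, orth U V ->
    ~ nest U V /\ ~ nest V U ;

  transverse_rho : forall U V : domain D, transverse U V ->
    rho V U !=set0 /\ ediam (rho V U) <= E%:E ;
  transverse_consistency : forall (U V : domain D) (z : Z), transverse U V ->
    Order.min (setdist (coord_proj U z) (rho V U))
      (setdist (coord_proj V z) (rho U V))
      <= E%:E ;
  nest_consistency : forall (U V : domain D) (z : Z), pnest V U ->
    Order.min (setdist (coord_proj U z) (rho V U))
      (ediam (coord_proj V z `|` rhomap_image V (coord_proj U z))) <= E%:E ;
  rho_consistency : forall U V W : domain D, nest U V ->
    pnest V W \/ (transverse V W /\ ~ orth W U) ->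
    setdist (rho U W) (rho V W) <= E%:E ;

  finite_complexity : exists n : nat, forall A : set (domain D),
    (forall U V, A U -> A V -> nest U V \/ nest V U) -> A #<= `I_n ;

  (* At most floor(N) domains: U may be minimal, with none properly nested. *)
  large_links : forall (U : domain D) (z z' : Z) (N : R),
    setdist (coord_proj U z) (coord_proj U z') = N%:E ->
    exists (k : nat) (T : 'I_k -> domain D),
      [/\ (k <= Num.truncn N)%N,
          (forall i, pnest (T i) U),
          (forall V, pnest V U ->
             (exists i, nest V (T i)) \/
             setdist (coord_proj V z) (coord_proj V z') < E%:E)
        & (forall i, setdist (coord_proj U z) (rho (T i) U) <= N%:E)] ;

  bounded_geodesic_image :
    forall (U V : domain D) (x y : coord_space U) (g : set (coord_space U)),
    pnest V U -> geodesic x y g ->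
    ediam (rhomap_image V g) <= E%:E \/
    g `&` neighbourhood E (rho V U) !=set0 ;

  partial_realisation :
    forall (J : Type) (V : J -> domain D) (p : forall j, coord_space (V j)),
    (forall i j, i <> j -> orth (V i) (V j)) ->
    (forall j, proj_image (V j) (p j)) ->
    exists z : Z,
      (forall j, setdist (coord_proj (V j) z) [set p j] <= E%:E) /\
      (forall j W, pnest (V j) W \/ transverse (V j) W ->
         setdist (coord_proj W z) (rho (V j) W) <= E%:E) ;

  coord_uniqueness : forall kappa : R, (0 <= kappa)%R -> exists theta : R,
    forall x y : Z, (theta <= mdist x y)%R ->
    exists V : domain D, kappa%:E <= setdist (coord_proj V x) (coord_proj V y)
}.

Definition is_hhs (R : realType) (Z : metricType R) (D : hhs_data Z) : Prop :=
  exists2 E : R, (0 <= E)%R & hhs_axioms D E.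

Definition normalised_hhs (R : realType) (Z : metricType R) (D : hhs_data Z) :
    Prop :=
  exists c : R, forall (U : domain D) (p : coord_space U),
    exists z : Z, setdist (coord_proj U z) [set p] <= c%:E.

Definition wedges (R : realType) (Z : metricType R) (D : hhs_data Z) : Prop :=
  forall U V : domain D,
    (exists2 T, nest T U & nest T V) ->
    exists! T, [/\ nest T U, nest T V
                 & forall T', nest T' U -> nest T' V -> nest T' T].

Definition clean_containers (R : realType) (Z : metricType R)
    (D : hhs_data Z) : Prop :=
  forall U T : domain D, pnest U T ->
    (exists2 V, pnest V T & orth V U) ->
    exists W, [/\ pnest W T, orth W U
                & forall V, pnest V T -> orth V U -> nest V W].

Definition strong_orthogonal (R : realType) (Z : metricType R)
    (D : hhs_data Z) : Prop :=
  forall U V : domain D, pnest U V -> exists2 W, pnest W V & orth U W.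

Definition weak_orthogonal (R : realType) (Z : metricType R)
    (D : hhs_data Z) : Prop :=
  forall U V : domain D, pnest U V -> ~ nest_minimal U ->
    exists2 W, pnest W V & orth U W.

Definition split_domain (R : realType) (Z : metricType R) (D : hhs_data Z)
    (U : domain D) : Prop :=
  exists W : domain D,
    [/\ nest_minimal W, nest W U & forall V, nest V U -> nest W V \/ orth W V].

Definition nonsplit_orthogonals (R : realType) (Z : metricType R)
    (D : hhs_data Z) : Prop :=
  forall U V : domain D, pnest U V ->
    split_domain U \/ exists2 W, pnest W V & orth W U.

Definition dense_product_regions (R : realType) (Z : metricType R)
    (D : hhs_data Z) : Prop :=
  exists M0 : R, forall (U : domain D) (p : coord_space U), ~ nest_minimal U ->
    exists2 V, pnest V U & setdist [set p] (rho V U) <= M0%:E.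

Definition bounded_split (R : realType) (Z : metricType R)
    (D : hhs_data Z) : Prop :=
  exists2 c : R, (0 <= c)%R & forall U : domain D,
    ~ nest_maximal U -> split_domain U -> ~ nest_minimal U ->
    ediam [set: coord_space U] <= c%:E.

Definition orth_property (R : realType) (Z : metricType R) (i : nat)
    (D : hhs_data Z) : Prop :=
  match i with
  | 1%N => strong_orthogonal D
  | 2%N => weak_orthogonal D
  | 3%N => weak_orthogonal D /\ dense_product_regions D
  | 4%N => nonsplit_orthogonals D /\ bounded_split D
  | 5%N => nonsplit_orthogonals D /\ dense_product_regions D
  | _ => False
  end.

(* The inclusion of index sets, as structures: D is the restriction of D' to
   a subset of the domains of D', where coordinate spaces are identified by
   the isometries f and all of the meaningful data agree.  The HHS constants
   of D and D' may differ. *)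
Definition hhs_included (R : realType) (Z : metricType R) (D D' : hhs_data Z) :
    Prop :=
  exists (i : domain D -> domain D')
         (f : forall U : domain D, coord_space U -> coord_space (i U)),
    [/\ injective i,
        (forall U V, nest (i U) (i V) <-> nest U V),
        (forall U V, orth (i U) (i V) <-> orth U V),
        (forall U, (forall p q, mdist (f U p) (f U q) = mdist p q) /\
                   (forall p', exists p, f U p = p')) &
    [/\ (forall U z, coord_proj (i U) z = f U @` coord_proj U z),
        (forall U V, pnest V U \/ transverse V U ->
           rho (i V) (i U) = f U @` rho V U)
      & (forall U V (p : coord_space U), pnest V U ->
           rhomap (i V) (f U p) = f V @` rhomap V p)]].

(* Main.v *)
(* Call a point p of CX remote when X is not minimal and p is far from rho^W_X
   for every W properly nested in X.  For each remote p we add a domain T whose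
   coordinate space is a point, with rho^T_X = {p}, nested in X and in whatever
   contains X, and orthogonal to whatever is orthogonal to X; dense product
   regions then hold by construction.  Partial realisation for T comes from
   that for X: since p is remote, consistency and the bounded geodesic image
   axiom force a point of Z whose X-coordinate is near p to have W-coordinate
   near rho^X_W(p) for every W properly nested in X, and this serves as rho^T_W.

   Only non-minimal domains receive new domains, and new domains are minimal,
   so the weak orthogonal property survives and (2) implies (3).  If X is split
   by a minimal W, then rho^V_X is near rho^W_X for every V properly nested in
   X, by partial realisation when V and W are orthogonal; with dense product
   regions, CX is bounded, so (3) implies (4) and (5) without changing the
   structure.  For (4) implies (5), a threshold above the bound on split
   coordinate spaces leaves split domains without remote points, so a split
   domain other than S stays split. *)
Require Import Defs.
From mathcomp Require Import all_boot all_order all_algebra.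
From mathcomp Require Import all_classical all_reals all_analysis.
From HB Require Import structures.
From mathcomp Require Import lra.

Set Implicit Arguments.
Unset Strict Implicit.
Unset Printing Implicit Defensive.

Import Order.TTheory GRing.Theory Num.Theory.

Local Open Scope classical_set_scope.
Local Open Scope ring_scope.
Local Open Scope card_scope.
Local Open Scope ereal_scope.

(** * Distances and one-point spaces *)

Section SetDistance.
Context (R : realType) (X : metricType R).
Implicit Types (A B g : set X) (a b x y p : X) (r e : R).

Lemma setdist_le A B a b r :
  A a -> B b -> (mdist a b <= r)%R -> setdist A B <= r%:E.
Proof.
move=> Aa Bb abr; apply: (@le_trans _ _ (mdist a b)%:E);
  last by rewrite lee_fin.
by apply: ereal_inf_lbound; exists a => //; exists b.
Qed.

(** An infimum need not be attained, so actual points cost some slack; the slack is taken to be 1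
    below, which is the source of the additive integers in the constants. *)
Lemma setdist_lt A B r e : (r < e)%R -> setdist A B <= r%:E ->
  exists a b, [/\ A a, B b & (mdist a b < e)%R].
Proof.
move=> re /le_lt_trans /(_ _) ABe.
have /ABe/ereal_inf_lt [_ [a Aa [b Bb <-]]] : r%:E < e%:E by rewrite lte_fin.
by rewrite lte_fin => ab; exists a, b.
Qed.

Lemma setdist_subset_refl A r : (0 <= r)%R -> A !=set0 -> setdist A A <= r%:E.
Proof. by move=> r0 [a Aa]; apply: (setdist_le Aa Aa); rewrite mdistxx. Qed.

Lemma ediam_leP A r :
  ediam A <= r%:E <-> forall a b, A a -> A b -> (mdist a b <= r)%R.
Proof.
split=> [Ar a b Aa Ab|Ar].
  rewrite -lee_fin; apply: le_trans Ar; apply: ereal_sup_ubound.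
  by exists a => //; exists b.
apply: ge_ereal_sup => _ [a Aa [b Ab <-]].
by rewrite lee_fin; exact: Ar.
Qed.

Lemma neighbourhood_le A r e :
  (r <= e)%R -> neighbourhood r A `<=` neighbourhood e A.
Proof. by move=> re x /= /le_trans; apply; rewrite lee_fin. Qed.

Lemma geodesic_refl x : geodesic x x [set x].
Proof.
exists 0%R, (fun=> x); split=> //.
  move=> s t; rewrite !in_itv/= -!eq_le => /eqP <- /eqP <-.
  by rewrite mdistxx subrr normr0.
apply/seteqP; split => [y ->|y [s _ <-]//].
by exists 0%R => //=; rewrite in_itv/= lexx.
Qed.

Lemma geodesic_ends x y g : geodesic x y g -> g x /\ g y.
Proof.
move=> [L [f [L0 fx fy _ ->]]]; split; [exists 0%R|exists L] => //=;
  by rewrite in_itv/= lexx// L0.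
Qed.

Lemma geodesic_mdist x y g p : geodesic x y g -> g p ->
  (mdist x p <= mdist x y)%R.
Proof.
move=> [L [f [L0 <- <- fE ->]]] [s sL <-].
have /andP[s0 s1] : (0 <= s <= L)%R by move: sL; rewrite /= in_itv.
rewrite !fE ?in_itv/= ?lexx ?L0 ?s0//.
by rewrite !sub0r !normrN !ger0_norm.
Qed.

Lemma hyperbolic_le r e : (r <= e)%R ->
  hyperbolic r X -> hyperbolic e X.
Proof.
move=> re [geo thin]; split=> // x y z a b c ga gb gc.
by apply: subset_trans (neighbourhood_le re); exact: thin ga gb gc.
Qed.

End SetDistance.

(** The phantom parameter [R] lets the one-point space carry a metric with values in each [R]. *)
Definition point_space (R : realType) : Type := unit.

HB.instance Definition _ (R : realType) := Choice.copy (point_space R) unit.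

Lemma point_space_eq (R : realType) (x y : point_space R) : x = y.
Proof. by case: x; case: y. Qed.

HB.instance Definition _ (R : realType) :=
  @isMetric.Build R (point_space R) (fun _ _ => 0%R) (fun=> erefl)
    (fun x y _ => point_space_eq x y) (fun _ _ => erefl)
    (fun _ _ _ => ler_wpDl (lexx 0) (lexx 0)).

Section Point.
Context (R : realType).

Lemma setdist_point (A B : set (point_space R)) (r : R) :
  (0 <= r)%R -> A tt -> B tt -> setdist A B <= r%:E.
Proof. by move=> r0 At Bt; apply: (setdist_le At Bt); rewrite mdistxx. Qed.

Lemma ediam_point (A : set (point_space R)) (r : R) :
  (0 <= r)%R -> ediam A <= r%:E.
Proof.
by move=> r0; apply/ediam_leP => x y _ _; rewrite (point_space_eq x y) mdistxx.
Qed.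

Lemma hyperbolic_point (r : R) : (0 <= r)%R -> hyperbolic r (point_space R).
Proof.
move=> r0; split=> [x y|x y z a b c xa _ _ [] _].
  by rewrite (point_space_eq y x); exists [set x]; exact: geodesic_refl.
apply: setdist_point => //; left; have [ax _] := geodesic_ends xa.
by rewrite (point_space_eq tt x).
Qed.

End Point.

(** * Adding one-point domains at remote points *)

Section Densify.
Context (R : realType) (Z : metricType R) (D : hhs_data Z) (M : R).

(** Membership in [proj_image X] is demanded because partial realisation accepts only such
    points. *)
Definition remote (X : domain D) (p : coord_space X) : Prop :=
  [/\ ~ nest_minimal X, proj_image X p
    & forall W, pnest W X -> M%:E < setdist [set p] (rho W X)].

Record dummy := Dummy {
  host : domain D ;
  spot : coord_space host ;
  spot_remote : remote spot
}.

Definition ddomain : Type := domain D + dummy.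

Definition dbase (U : ddomain) : domain D :=
  match U with inl U => U | inr a => host a end.

Definition dspace (U : ddomain) : metricType R :=
  match U with inl U => coord_space U | inr _ => point_space R end.

Definition dproj (U : ddomain) (z : Z) : set (dspace U) :=
  match U return set (dspace U) with
  | inl U => coord_proj U z
  | inr _ => setT
  end.

(** With [dorth] below, distinct dummies on one host are transverse, and so are a dummy and any
    domain properly nested in its host. *)
Definition dnest (U V : ddomain) : Prop :=
  match V with inl V => nest (dbase U) V | inr _ => U = V end.

Definition dorth (U V : ddomain) : Prop := orth (dbase U) (dbase V).

(** Three exclusive cases: [W] is the host, lies properly below it, or is not nested in it. The
    first needs a transport, since [spot a] lives in the coordinate space of the host. *)
Definition dummy_rho (a : dummy) (W : domain D) : set (coord_space W) :=
  [set q | (exists e : host a = W,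
              q = eq_rect (host a) (fun U => coord_space U : Type) (spot a) W e)
        \/ (pnest W (host a) /\ rhomap W (spot a) q)
        \/ (~ nest W (host a) /\ rho (host a) W q)].

Arguments dummy_rho : clear implicits.

Definition drho (V U : ddomain) : set (dspace U) :=
  match U return set (dspace U) with
  | inl U => match V with inl V => rho V U | inr a => dummy_rho a U end
  | inr _ => setT
  end.

Definition drhomap (U V : ddomain) : dspace U -> set (dspace V) :=
  match V return dspace U -> set (dspace V) with
  | inl V => match U return dspace U -> set (coord_space V) with
             | inl U => @rhomap _ _ D U V
             (* A default value: nothing is properly nested in a dummy. *)
             | inr _ => fun=> set0
             end
  | inr _ => fun=> setT
  end.

Arguments dproj : clear implicits.
Arguments drho : clear implicits.

Definition densify : hhs_data Z :=
  HHSData dproj dnest dorth drho (@drhomap).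

Context (E : R) (E0 : (0 <= E)%R) (hD : hhs_axioms D E).
Context (EM : (3 * E + 2 <= M)%R).

(** * Relative projections of the new domains *)

Lemma dummy_rho_host a : dummy_rho a (host a) = [set spot a].
Proof.
apply/seteqP; split=> [q [[e ->]|[[[_ ]]//|[]]]|q ->].
- by rewrite (Prop_irrelevance e erefl).
- by have := nest_refl hD (host a).
- by left; exists erefl.
Qed.

Lemma dummy_rho_below a W : pnest W (host a) ->
  dummy_rho a W = rhomap W (spot a).
Proof.
move=> Wa; apply/seteqP; split=> [q [[e _]|[[_]//|[nWa]]]|q ?].
- by case: Wa => _ /(_ (esym e)).
- by case: Wa.
- by right; left.
Qed.

Lemma dummy_rho_other a W : ~ nest W (host a) ->
  dummy_rho a W = rho (host a) W.
Proof.
move=> nWa; apply/seteqP; split=> [q [[e _]|[[[]]//|[_]//]]|q ?].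
- by case: nWa; rewrite e; exact: (nest_refl hD).
- by right; right.
Qed.

(** The threshold [3 * E + 2] is what the next two lemmas contradict: a path of length at most
    [2 * E + 1] followed by a jump below [E + 1], or jumps below [E + 1], at most [E] and below
    [E + 1]. *)
Lemma spot_far a W r : pnest W (host a) -> rho W (host a) r ->
  (3 * E + 2 < mdist (spot a) r)%R.
Proof.
move=> Wa ar; have [_ _ /(_ W Wa)] := spot_remote a.
apply: contraPlt => dr; apply/negP; rewrite -leNgt.
by apply: (@setdist_le _ _ _ _ (spot a) r) => //; apply: le_trans dr EM.
Qed.

Lemma geodesic_spot_rhomap a W x g : pnest W (host a) ->
  (mdist (spot a) x <= 2 * E + 1)%R -> geodesic (spot a) x g ->
  ediam (rhomap_image W g) <= E%:E.
Proof.
move=> Wa ax gx; have [//|[y [gy]]] := bounded_geodesic_image hD Wa gx.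
have E1 : (E < E + 1)%R by rewrite ltrDl.
case/(setdist_lt E1) => _ [r [-> Wr yr]].
exfalso; have := spot_far Wa Wr; have := geodesic_mdist gx gy.
by have := metric_triangle (spot a) y r; lra.
Qed.

(** Remoteness rules out the first alternative of nesting consistency, so the [W]-coordinate of [z]
    is near [rhomap W x] for a host coordinate [x] of [z]. A geodesic from [spot a] to [x] avoids
    [rho W (host a)], and bounded geodesic image then compares [rhomap W x] with
    [rhomap W (spot a)]. *)
Lemma coord_proj_near_spot a W z : pnest W (host a) ->
  setdist (coord_proj (host a) z) [set spot a] <= E%:E ->
  setdist (coord_proj W z) (rhomap W (spot a)) <= (2 * E + 1)%:E.
Proof.
move=> Wa; have E1 : (E < E + 1)%R by rewrite ltrDl.
have E_ge0 := E0; case/(setdist_lt E1) => x [_ [zx -> xa]].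
have /ediam_leP diamz := proj_diam hD (host a) z.
have := nest_consistency hD z Wa; rewrite ge_min => /orP[|].
  case/(setdist_lt E1) => y [r [zy Wr yr]].
  exfalso; have := spot_far Wa Wr; have := metric_triangle (spot a) x r.
  have := metric_triangle x y r; have := diamz _ _ zx zy.
  by rewrite (metric_sym (spot a) x); lra.
move=> /ediam_leP diamW.
have [g gx] := (coord_hyperbolic hD (host a)).1 (spot a) x.
have /ediam_leP diamg : ediam (rhomap_image W g) <= E%:E.
  by apply: geodesic_spot_rhomap gx => //; rewrite metric_sym; lra.
have [ga gx'] := geodesic_ends gx.
have [w zw] := proj_nonempty hD W z.
have [b xb] := pnest_rhomap hD x Wa.
have [c ac] := pnest_rhomap hD (spot a) Wa.
apply: (setdist_le zw ac); apply: (le_trans (metric_triangle _ b _)).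
have : (mdist w b <= E)%R by apply: diamW; [left|right; exists x].
have : (mdist b c <= E)%R by apply: diamg; [exists x|exists (spot a)].
by lra.
Qed.

(** * The axioms for the enlarged structure *)

Lemma dnest_base U V : dnest U V -> nest (dbase U) (dbase V).
Proof. by case: V => //= a ->; exact: (nest_refl hD). Qed.

Lemma dnest_refl U : dnest U U.
Proof. by case: U => [U|a] //=; exact: (nest_refl hD). Qed.

Lemma dnest_trans U V W : dnest U V -> dnest V W -> dnest U W.
Proof.
case: W => [W|a] /=; last by move=> UV Va; subst V.
by move=> /dnest_base; exact: (nest_trans hD).
Qed.

Lemma dnest_antisym U V : dnest U V -> dnest V U -> U = V.
Proof.
case: V U => [V|a] [U|b] //=.
by move=> UV VU; congr inl; exact: (nest_antisym hD UV VU).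
Qed.

Lemma dorth_incomparable U V : dorth U V -> ~ dnest U V /\ ~ dnest V U.
Proof.
by case/(orth_incomparable hD) => nUV nVU; split=> /dnest_base.
Qed.

Lemma pnest_inl U V :
  @pnest _ _ densify (inl U) (inl V) <-> pnest U V.
Proof.
by split=> -[UV nUV]; split=> //; [move=> e; apply: nUV; rewrite e|case].
Qed.

Lemma pnest_inrN U a : ~ @pnest _ _ densify U (inr a).
Proof. by case. Qed.

Lemma drho_nonempty_diam U V :
  @pnest _ _ densify V U \/ @transverse _ _ densify U V ->
  drho V U !=set0 /\ ediam (drho V U) <= (2 * E + 1)%:E.
Proof.
have E_ge0 := E0; case: U => [U|a] h /=; last first.
  by split; [exists tt|apply: ediam_point; lra].
have E2 : E%:E <= (2 * E + 1)%:E by rewrite lee_fin; lra.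
case: V h => [V|b] /= h.
  have [ne dm] : rho V U !=set0 /\ ediam (rho V U) <= E%:E.
    case: h => [/pnest_inl|[nUV UV VU]]; first exact: pnest_rho.
    exact: transverse_rho.
  by split=> //; apply: le_trans E2.
have [Ub|nUb] := pselect (nest U (host b)); last first.
  rewrite dummy_rho_other//.
  have [ne dm] : rho (host b) U !=set0 /\ ediam (rho (host b) U) <= E%:E.
    case: h => [[bU _]|[nUV UV VU]].
      apply: (pnest_rho hD); split=> // bU'; apply: nUb.
      by rewrite -bU'; exact: (nest_refl hD).
    by apply: transverse_rho.
  by split=> //; apply: le_trans E2.
have [<-|ne] := pselect (host b = U).
  rewrite dummy_rho_host; split; first by exists (spot b).
  by apply/ediam_leP => _ _ -> ->; rewrite mdistxx; lra.
have Ub' : pnest U (host b) by split=> // /esym.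
rewrite dummy_rho_below//; split; first exact: (pnest_rhomap hD).
(* Bounded geodesic image on the constant geodesic bounds the single value [rhomap U (spot b)]. *)
apply: le_trans E2; have := geodesic_spot_rhomap Ub' _ (geodesic_refl (spot b)).
rewrite /rhomap_image bigcup_set1; apply.
by rewrite mdistxx; lra.
Qed.

Lemma densify_nest_top :
  (ddomain -> False) \/ exists! S, @nest_maximal _ _ densify S.
Proof.
case: (nest_top hD) => [De|[S [Smax Suniq]]].
  by left=> -[U|a]; [exact: De U|exact: De (host a)].
right; exists (inl S); split=> [[V|a]//= /Smax -> //|[T|a] Tmax].
  by rewrite (Suniq T)// => V TV; have [] := Tmax (inl V) TV.
by have := Tmax (inl (host a)) (nest_refl hD (host a)).
Qed.

Lemma densify_container T U : dnest U T ->
  (exists2 V, dnest V T & dorth V U) ->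
  exists2 W, @pnest _ _ densify W T
    & forall V, dorth V U -> dnest V T -> dnest V W.
Proof.
case: T => [T|a] /= UT [V VT VU]; last first.
  by move: VU; rewrite VT UT => /(orth_irrefl hD).
have [|W WT Wc] := orth_container hD UT; first by exists (dbase V).
by exists (inl W); [apply/pnest_inl|move=> V' V'U; exact: Wc].
Qed.

Lemma densify_rho_consistency U V W : dnest U V ->
  @pnest _ _ densify V W \/
    (@transverse _ _ densify V W /\ ~ @orth _ _ densify W U) ->
  setdist (drho U W) (drho V W) <= (2 * E + 1)%:E.
Proof.
have E2 : (0 <= 2 * E + 1)%R by have := E0; lra.
case: W => [W|c] UV VW; last by apply: setdist_point.
case: V UV VW => [V|b] /= UV VW; last first.
  rewrite UV; have [] := @drho_nonempty_diam (inl W) (inr b); last first.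
    by move=> ? _; exact: setdist_subset_refl.
  case: VW => [|[[? ? ?] _]]; [by left|right; split=> //].
  by move=> /(orth_sym hD).
have {}VW : pnest V W \/ transverse V W /\ ~ orth W (dbase U).
  by case: VW => [/pnest_inl|]; [left|right].
have old : setdist (rho (dbase U) W) (rho V W) <= (2 * E + 1)%:E.
  apply: le_trans (rho_consistency hD UV VW) _.
  by rewrite lee_fin; have := E0; lra.
case: U UV VW old => [//|a] /= aV VW old.
(* Since [W] is not nested in [V], it is not nested in the host either, so the set is that of the
   host and the old axiom applies. *)
rewrite dummy_rho_other// => Wa.
case: VW => [[VW nVW]|[[_ _ nWV] _]].
  by apply: nVW; apply: (nest_antisym hD) VW (nest_trans hD Wa aV).
by apply: nWV; exact: (nest_trans hD Wa aV).
Qed.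

Lemma densify_finite_complexity : exists n : nat, forall A : set ddomain,
  (forall U V, A U -> A V -> dnest U V \/ dnest V U) -> A #<= `I_n.
Proof.
have [n chainn] := finite_complexity hD; exists n.+1 => A chainA.
have /pcard_leP/injfunPex[f fun_f inj_f] : [set U | A (inl U)] #<= `I_n.
  by apply: chainn => U V /= AU AV; exact: chainA AU AV.
apply/pcard_leP/injfunPex.
(* A chain contains at most one dummy, which takes the spare index [n]. *)
exists (fun U => if U is inl U then f U else n) => /=.
  by move=> [U|a] //= AU; rewrite ltnS ltnW//; exact: fun_f.
move=> [U|a] [V|b]; rewrite !inE => AU AV.
- by move=> fUV; congr inl; apply: inj_f; rewrite ?inE.
- by move=> fUn; have := fun_f U AU; rewrite /= fUn ltnn.
- by move=> fVn; have := fun_f V AV; rewrite /= -fVn ltnn.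
- by case: (chainA _ _ AU AV).
Qed.

Lemma densify_large_links U z z' (N : R) :
  setdist (dproj U z) (dproj U z') = N%:E ->
  exists (k : nat) (T : 'I_k -> ddomain),
    [/\ (k <= Num.truncn N)%N,
        (forall i, @pnest _ _ densify (T i) U),
        (forall V, @pnest _ _ densify V U ->
           (exists i, dnest V (T i)) \/
           setdist (dproj V z) (dproj V z') < (2 * E + 1)%:E)
      & (forall i, setdist (dproj U z) (drho (T i) U) <= N%:E)].
Proof.
case: U => [U|a] /= UN; last first.
  by exists 0%N, (fun=> inr a); split=> // [[]|V /pnest_inrN|[]].
have [k [T [kN TU Tlarge Tnear]]] := large_links hD UN.
exists k, (fun i => inl (T i)); split=> // [i|]; first exact/pnest_inl.
have E_ge0 := E0.
case=> [V /pnest_inl/Tlarge [|small]|a _]; [by left|right|right].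
  by apply: lt_le_trans small _; rewrite lee_fin; lra.
(* A dummy sees distance 0, which is strictly below [2 * E + 1] even when [E] is 0; the old list of
   domains therefore suffices. *)
apply: (@le_lt_trans _ _ 0%:E); first exact: setdist_point.
by rewrite lte_fin; lra.
Qed.

Definition dbase_point (U : ddomain) : dspace U -> coord_space (dbase U) :=
  match U return dspace U -> coord_space (dbase U) with
  | inl U => id
  | inr a => fun=> spot a
  end.

(** Each dummy is replaced by its host with target [spot]; orthogonality of dummies is by definition
    that of their hosts. The bounds for a dummy then follow the three cases of [dummy_rho]. *)
Lemma densify_partial_realisation (J : Type) (V : J -> ddomain)
    (p : forall j, dspace (V j)) :
  (forall i j, i <> j -> dorth (V i) (V j)) ->
  (forall j, @proj_image _ _ densify (V j) (p j)) ->
  exists z : Z,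
    (forall j, setdist (dproj (V j) z) [set p j] <= (2 * E + 1)%:E) /\
    (forall j W,
       @pnest _ _ densify (V j) W \/ @transverse _ _ densify (V j) W ->
       setdist (dproj W z) (drho (V j) W) <= (2 * E + 1)%:E).
Proof.
move=> Vorth pV.
have E2 : (0 <= 2 * E + 1)%R by have := E0; lra.
have EE : E%:E <= (2 * E + 1)%:E by rewrite lee_fin; have := E0; lra.
have [|z [zp zW]] :=
  partial_realisation hD (p := fun j => dbase_point (p j)) Vorth.
  move=> j; move: (V j) (p j) (pV j) => [U|a] q //= _.
  by have [] := spot_remote a.
exists z; split=> [j|j W].
  move: (V j) (p j) (zp j) => [U|a] q /= zq; first exact: le_trans zq EE.
  by apply: setdist_point => //=; case: q {zq}.
case: W => [W|b] VW; last exact: setdist_point.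
move: (V j) (p j) (zp j) (zW j) VW => [U|a] /= q zq {}zW VW.
  apply: le_trans EE; apply: zW.
  by case: VW => [/pnest_inl|]; [left|right].
have [Wa|nWa] := pselect (nest W (host a)); last first.
  rewrite dummy_rho_other//; apply: le_trans EE; apply: zW.
  case: VW => [[aW _]|[? ? ?]]; [left|right]; split=> //.
  by move=> aW'; apply: nWa; rewrite aW'; exact: (nest_refl hD).
have [<-|ne] := pselect (host a = W).
  by rewrite dummy_rho_host; exact: le_trans zq EE.
have Wa' : pnest W (host a) by split=> // /esym.
by rewrite dummy_rho_below//; exact: coord_proj_near_spot.
Qed.

(** Bounds measured inside a dummy hold because its space is a point, and old bounds survive
    enlarging [E]. The new constant comes from [coord_proj_near_spot]. *)
Lemma densify_axioms : hhs_axioms densify (2 * E + 1)%R.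
Proof.
have E_ge0 := E0.
have E2 : (0 <= 2 * E + 1)%R by lra.
have EE : (E <= 2 * E + 1)%R by lra.
have EE' : E%:E <= (2 * E + 1)%:E by rewrite lee_fin.
split.
- case=> [U|a] /=; last exact: hyperbolic_point.
  exact: hyperbolic_le (coord_hyperbolic hD U).
- by case=> [U|a] z /=; [exact: (proj_nonempty hD)|exists tt].
- case=> [U|a] z /=; last exact: ediam_point.
  exact: le_trans (proj_diam hD U z) EE'.
- case=> [U|a] x y /=; last first.
    by apply: setdist_point => //; rewrite addr_ge0// mulr_ge0// mdist_ge0.
  apply: le_trans (proj_lipschitz hD U x y) _.
  by rewrite lee_fin lerD// ler_wpM2r// mdist_ge0.
- case=> [U|a] x y g /= Ux Uy gxy; last first.
    by case=> _; apply: setdist_point => //; exists point.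
  apply: subset_trans (neighbourhood_le EE).
  exact: (proj_quasiconvex hD) gxy.
- exact: dnest_refl.
- exact: dnest_antisym.
- exact: dnest_trans.
- exact: densify_nest_top.
- by move=> U V VU; apply: drho_nonempty_diam; left.
- move=> U [V|a] p VU; last by exists tt.
  case: U p VU => [U|a] p; last by case.
  by move=> /pnest_inl; exact: (pnest_rhomap hD).
- by move=> U V; exact: (orth_sym hD).
- by move=> U; exact: (orth_irrefl hD).
- by move=> U V W /dnest_base; exact: (orth_nest hD).
- exact: densify_container.
- exact: dorth_incomparable.
- by move=> U V UV; apply: drho_nonempty_diam; right.
- move=> [U|a] [V|b] z UV; rewrite ge_min.
  + have := transverse_consistency hD z UV; rewrite ge_min.
    by case/orP=> /le_trans/(_ EE') /= ->; rewrite ?orbT.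
  + by apply/orP; right; exact: setdist_point.
  + by apply/orP; left; exact: setdist_point.
  + by apply/orP; left; exact: setdist_point.
- move=> [U|a] [V|b] z VU; rewrite ge_min.
  + have/pnest_inl{}VU := VU; have := nest_consistency hD z VU; rewrite ge_min.
    by case/orP=> /le_trans/(_ EE') /= ->; rewrite ?orbT.
  + by apply/orP; right; exact: ediam_point.
  + by case: VU.
  + by apply/orP; right; exact: ediam_point.
- exact: densify_rho_consistency.
- exact: densify_finite_complexity.
- exact: densify_large_links.
- move=> U [V|b] x y g VU gxy; last by left; exact: ediam_point.
  case: U x y g VU gxy => [U|a] x y g; last by case.
  move=> /pnest_inl VU gxy.
  have [dg|[w [gw Vw]]] := bounded_geodesic_image hD VU gxy.
    by left; exact: le_trans dg EE'.
  by right; exists w; split=> //; exact: neighbourhood_le EE _ Vw.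
- exact: densify_partial_realisation.
- move=> kappa /(coord_uniqueness hD)[theta far].
  by exists theta => x y /far[V dV]; exists (inl V).
Qed.

(** * Properties of the enlarged structure *)

Lemma densify_wedges : wedges D -> wedges densify.
Proof.
move=> hw U V [T TU TV].
have dummy_wedge a U' V' : dnest T U' -> dnest T V' -> U' = inr a ->
    exists! W, [/\ dnest W U', dnest W V'
                 & forall T', dnest T' U' -> dnest T' V' -> dnest T' W].
  move=> TU' TV' U'a; subst U'; move: TU' => /= Ta; subst T.
  by exists (inr a); split=> [|W [/= ->]].
case: U TU => [U|a] TU; last exact: dummy_wedge TU TV erefl.
case: V TV => [V|b] TV; last first.
  have [W [[WV WU Wmax] Wuniq]] := dummy_wedge b _ _ TV TU erefl.
  exists W; split=> [|W' [W'U W'V W'max]].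
    by split=> // T' T'U T'V; exact: Wmax.
  by apply: Wuniq; split=> // T' T'U T'V; exact: W'max.
(* A dummy nested in two old domains has its host nested in both, so the old wedge serves. *)
have [|W [[WU WV Wmax] _]] := hw U V; first by exists (dbase T).
exists (inl W); split=> [|W' [W'U W'V W'max]].
  by split=> // T'; exact: Wmax.
by apply: dnest_antisym; [exact: W'max|exact: Wmax].
Qed.

(** A dummy may be properly nested in [T] while its host equals [T]; an orthogonal domain inside [T]
    excludes this. *)
Lemma orth_pnest (U V T : domain D) :
  orth U V -> nest U T -> nest V T -> pnest U T.
Proof.
move=> UV UT VT; split=> // UT'; have [_] := orth_incomparable hD UV.
by rewrite UT'.
Qed.

Lemma densify_clean_containers :
  clean_containers D -> clean_containers densify.
Proof.
move=> hc U [T|a] [UT nUT]; last by case: nUT.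
case=> V [VT _] VU; have UV := orth_sym hD VU.
have [||W [WT WU Wc]] := hc (dbase U) T.
- exact: orth_pnest UV UT VT.
- by exists (dbase V) => //; exact: orth_pnest VU VT UT.
exists (inl W); split=> //; first exact/pnest_inl.
move=> V' [V'T _] V'U; apply: Wc => //.
exact: orth_pnest V'U V'T UT.
Qed.

Lemma densify_normalised : normalised_hhs D -> normalised_hhs densify.
Proof.
move=> [c hc]; exists (Num.max c 0%R) => -[U|a] p.
  have [z zp] := hc U p; exists z; rewrite (le_trans zp)//.
  by rewrite lee_fin le_max lexx.
have [z _] := hc (host a) (spot a); exists z.
by apply: setdist_point => //; [rewrite le_max lexx orbT|case: p].
Qed.

Lemma densify_included : hhs_included D densify.
Proof.
exists (@inl _ _), (fun U p => p); split=> //.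
- by move=> U V [].
- by move=> U; split=> // p; exists p.
split=> *; by rewrite image_id.
Qed.

Lemma densify_minimal_inr a : @nest_minimal _ _ densify (inr a).
Proof. by []. Qed.

Lemma densify_minimal U :
  @nest_minimal _ _ densify (inl U) <-> nest_minimal U.
Proof.
split=> [Umin V VU|Umin [V|a]].
- by have [] := Umin (inl V) VU.
- by move=> /= /Umin ->.
- move=> /= aU; have [anmin _ _] := spot_remote a.
  by case: anmin; rewrite (Umin _ aU).
Qed.

Lemma densify_dense_product_regions :
  normalised_hhs D -> dense_product_regions densify.
Proof.
(* Normalisation moves [p] less than [c + 1] to a projected point [x]. Either [x] is less than
   [M + 1] from an old [rho] set, or [x] is remote and has its own dummy. *)
move=> [c hc]; exists (M + c + 2)%R => -[U|a] p; last first.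
  by have := densify_minimal_inr (a := a).
move=> /densify_minimal Unmin.
have [z] := hc U p; have c1 : (c < c + 1)%R by rewrite ltrDl.
case/(setdist_lt c1) => x [_ [zx -> xp]]; rewrite metric_sym in xp.
have := mdist_ge0 p x; have E_ge0 := E0; have EM_le := EM => px0.
have [[V VU Vx]|far] :=
  pselect (exists2 V, pnest V U & setdist [set x] (rho V U) <= M%:E).
  have M1 : (M < M + 1)%R by rewrite ltrDl.
  case/(setdist_lt M1): Vx => _ [r [-> Vr xr]].
  exists (inl V); first exact/pnest_inl.
  apply: (@setdist_le _ _ _ _ p r) => //.
  by have := metric_triangle p x r; lra.
have xremote : remote x.
  split=> //; first by exists z.
  by move=> W WU; rewrite ltNge; apply/negP => Wx; apply: far; exists W.
exists (inr (Dummy xremote)).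
  by split=> //=; exact: (nest_refl hD).
rewrite /= (dummy_rho_host (Dummy xremote)).
by apply: (@setdist_le _ _ _ _ p x) => //; lra.
Qed.

Lemma densify_weak_orthogonal : weak_orthogonal D -> weak_orthogonal densify.
Proof.
move=> hw [U|a] V; last by move=> _ /(_ (@densify_minimal_inr a)).
case: V => [V|b] UV; last by case: UV.
move=> /densify_minimal Unmin; have /pnest_inl{}UV := UV.
have [W WV UW] := hw U V UV Unmin.
by exists (inl W) => //; exact/pnest_inl.
Qed.

Lemma densify_nonsplit_orthogonals (c : R) : (c <= M)%R ->
  (forall U : domain D, ~ nest_maximal U -> split_domain U ->
     ~ nest_minimal U -> ediam [set: coord_space U] <= c%:E) ->
  nonsplit_orthogonals D -> nonsplit_orthogonals densify.
Proof.
move=> cM bounded hns [U|a] V UV; last first.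
  left; exists (inr a); split=> // V' V'a; left.
  by rewrite V'a; exact: dnest_refl.
case: V UV => [V|b] UV; last by case: UV.
have {UV}[UV nUV] : pnest U V by exact/pnest_inl.
have [[W [Wmin WU Wsplit]]|[W WV WU]] := hns U V (conj UV nUV); last first.
  by right; exists (inl W) => //; exact/pnest_inl.
left; exists (inl W); split=> //; first exact/densify_minimal.
case=> [T|a] /= TU; first exact: Wsplit.
have [Wa|] := Wsplit _ TU; last by right.
have [anmin _ afar] := spot_remote a.
(* If [W] is nested in the host of a dummy below [U], it splits that host too, whose space then has
   diameter at most [c]; this contradicts remoteness from [rho W (host a)]. *)
have Wa' : pnest W (host a).
  by split=> // Wa'; apply: anmin; rewrite -Wa'.
have /ediam_leP diam : ediam [set: coord_space (host a)] <= c%:E.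
  apply: bounded => // [amax|].
    have Va := amax V (nest_trans hD TU UV).
    by apply: nUV; apply: (nest_antisym hD UV); rewrite Va.
  exists W; split=> // T Ta; apply: Wsplit; exact: (nest_trans hD Ta TU).
have [[r Wr] _] := pnest_rho hD Wa'.
have := afar W Wa'; rewrite ltNge => /negP[].
apply: (@setdist_le _ _ _ _ (spot a) r) => //.
by apply: le_trans cM; exact: diam.
Qed.

End Densify.

(** * Split domains *)

(** The minimal domains, exempt from the weak orthogonal property, are split by themselves. *)
Lemma weak_nonsplit_orthogonals (R : realType) (Z : metricType R)
    (D : hhs_data Z) : is_hhs D ->
  weak_orthogonal D -> nonsplit_orthogonals D.
Proof.
move=> [E _ hD] hw U V UV; have [Umin|Unmin] := pselect (nest_minimal U).
  left; exists U; split=> // [|W /Umin ->]; first exact: (nest_refl hD).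
  by left; exact: (nest_refl hD).
right; have [W WV UW] := hw U V UV Unmin.
by exists W => //; exact: (orth_sym hD).
Qed.

Section SplitBounded.
Context (R : realType) (Z : metricType R) (D : hhs_data Z) (E : R).
Context (hD : hhs_axioms D E).

(* The partial realisation of the pair [V], [W] lies near both [rho] sets. *)
Lemma rho_orth_near (U V W : domain D) (z : Z) r s :
  pnest V U -> pnest W U -> orth V W -> rho V U r -> rho W U s ->
  (mdist r s <= 5 * E + 2)%R.
Proof.
move=> VU WU VW Vr Ws; have E1 : (E < E + 1)%R by rewrite ltrDl.
pose X (b : bool) := if b then V else W.
(* The targets are arbitrary; [z] only supplies points in the projection images. *)
pose p b : coord_space (X b) := projT1 (cid (proj_nonempty hD (X b) z)).
have Xorth i j : i <> j -> orth (X i) (X j).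
  by case: i j => -[]//= _; exact: (orth_sym hD).
have [|x [_ xrho]] := partial_realisation hD (p := p) Xorth.
  by move=> b; exists z => //; rewrite /p; case: cid.
have /(setdist_lt E1)[a [r' [xa Vr' ar']]] := xrho true U (or_introl VU).
have /(setdist_lt E1)[b [s' [xb Ws' bs']]] := xrho false U (or_introl WU).
have /ediam_leP/(_ a b xa xb) ab := proj_diam hD U x.
have /ediam_leP/(_ r r' Vr Vr') rr' := (pnest_rho hD VU).2.
have /ediam_leP/(_ s' s Ws' Ws) ss' := (pnest_rho hD WU).2.
(* The path [r], [r'], [a], [b], [s'], [s] has three steps of at most [E] and two below [E + 1]. *)
have := metric_triangle r r' s; have := metric_triangle r' a s.
have := metric_triangle a b s; have := metric_triangle b s' s.
by rewrite (metric_sym r' a); lra.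
Qed.

Lemma rho_nest_near (U V W : domain D) r s :
  nest W V -> pnest W U -> pnest V U -> rho W U r -> rho V U s ->
  (mdist r s <= 3 * E + 1)%R.
Proof.
move=> WV WU VU Wr Vs; have E1 : (E < E + 1)%R by rewrite ltrDl.
have /(setdist_lt E1)[r' [s' [Wr' Vs' rs']]] :=
  rho_consistency hD WV (or_introl VU).
have /ediam_leP/(_ r r' Wr Wr') rr' := (pnest_rho hD WU).2.
have /ediam_leP/(_ s' s Vs' Vs) ss' := (pnest_rho hD VU).2.
by have := metric_triangle r r' s; have := metric_triangle r' s' s; lra.
Qed.

Lemma dense_bounded_split : (0 <= E)%R -> normalised_hhs D ->
  dense_product_regions D -> bounded_split D.
Proof.
(* [C] adds [M + 1], for reaching a dense [rho] set, to the [5 * E + 2] separating it from that of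
   the splitting domain; the absolute value keeps [C] nonnegative. *)
move=> E0 [c hc] [M hM]; pose C := (`|M| + 5 * E + 3)%R.
have C0 : (0 <= C)%R by rewrite /C; have := normr_ge0 M; lra.
exists (C + C)%R; first by rewrite addr_ge0.
move=> U _ [W [Wmin WU Wsplit]] Unmin.
have WU' : pnest W U by split=> // WU'; apply: Unmin; rewrite -WU'.
have [[r Wr] _] := pnest_rho hD WU'.
have near_r p : (mdist p r <= C)%R.
  have [z _] := hc U p.
  have [V VU] := hM U p Unmin; have M1 : (M < M + 1)%R by rewrite ltrDl.
  case/(setdist_lt M1) => _ [s [-> Vs ps]].
  have sr : (mdist s r <= 5 * E + 2)%R.
    have [WV|WV] := Wsplit V VU.1.
      have := rho_nest_near WV WU' VU Wr Vs.
      by rewrite (metric_sym s); lra.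
    by rewrite metric_sym; exact: rho_orth_near z _ _ WU' VU WV Wr Vs.
  have := metric_triangle p s r; have := ler_norm M; rewrite /C; lra.
apply/ediam_leP => a b _ _; apply: (le_trans (metric_triangle a r b)).
by rewrite lerD// metric_sym.
Qed.

End SplitBounded.

Lemma densify_spec (R : realType) (Z : metricType R) (D : hhs_data Z)
    (E M : R) :
  (0 <= E)%R -> hhs_axioms D E -> (3 * E + 2 <= M)%R ->
  normalised_hhs D -> wedges D -> clean_containers D ->
  [/\ is_hhs (densify D M), normalised_hhs (densify D M),
      hhs_included D (densify D M)
    & [/\ wedges (densify D M), clean_containers (densify D M)
        & dense_product_regions (densify D M)]].
Proof.
move=> E0 hD EM hnorm hw hc.
split; [|exact: densify_normalised|exact: densify_included|split].
- exists (2 * E + 1)%R; first by lra.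
  exact: (densify_axioms E0 hD EM).
- exact: (densify_wedges hD hw).
- exact: (densify_clean_containers hD hc).
- exact: (densify_dense_product_regions E0 hD EM hnorm).
Qed.

Theorem lemma7p4 (R : realType) (q : R) (Z : metricType R) (D : hhs_data Z)
    (hZ : quasigeodesic_space q Z) (hD : is_hhs D) (hnorm : normalised_hhs D)
    (hwedges : wedges D) (hclean : clean_containers D)
    (i j : nat) (hi : (1 <= i)%N) (hij : (i < j)%N) (hj : (j <= 5)%N)
    (hprop : orth_property i D) :
  exists D' : hhs_data Z,
    is_hhs D' /\ normalised_hhs D' /\ hhs_included D D' /\
    wedges D' /\ clean_containers D' /\ orth_property j D'.
Proof.
have included_refl : hhs_included D D.
  exists id, (fun U p => p); split=> //.
    by move=> U; split=> // p; exists p.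
  by split=> *; rewrite image_id.
have bounded (D' : hhs_data Z) : is_hhs D' -> normalised_hhs D' ->
    dense_product_regions D' -> bounded_split D'.
  by move=> [e e0 he]; exact: dense_bounded_split he e0.
have weak_dense (D' : hhs_data Z) : is_hhs D' -> normalised_hhs D' ->
    weak_orthogonal D' /\ dense_product_regions D' -> (2 < j)%N ->
    orth_property j D'.
  move=> hD' hnorm' [hw hd].
  move: j hj {hij} => [|[|[|[|[|[|]]]]]]//= _ _; split=> //.
  - exact: weak_nonsplit_orthogonals.
  - exact: bounded.
  - exact: weak_nonsplit_orthogonals.
have [E E0 hDE] := hD.
have [i2|i2] := leqP i 2.
  have hw : weak_orthogonal D.
    move: i i2 hi hprop {hij} => [|[|[|]]]//= _ _ hs U V UV _.
    exact: hs U V UV.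
  have [j2|j2] := leqP j 2.
    have -> : j = 2%N by apply/eqP; rewrite eqn_leq j2 (leq_ltn_trans hi hij).
    by exists D.
  have [h1 h2 h3 [h4 h5 h6]] :=
    densify_spec E0 hDE (lexx _) hnorm hwedges hclean.
  exists (densify D (3 * E + 2)); do 5 (split=> //).
  by apply: weak_dense => //; split=> //; exact: densify_weak_orthogonal.
have [i3|i3] := eqVneq i 3%N.
  rewrite {i hi i2}i3 in hij hprop.
  (* From (3) the structure stays unchanged. *)
  by exists D; do 5 (split=> //); apply: weak_dense => //; exact: ltnW.
have {i2 i3} i4 : i = 4%N.
  by apply/eqP; rewrite eqn_leq -ltnS (leq_trans hij hj) ltn_neqAle eq_sym i3.
have j5 : j = 5%N by apply/eqP; rewrite eqn_leq hj -i4.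
rewrite i4 j5 in hprop *; have [hns [c c0 hc]] := hprop.
(* This threshold dominates both the [3 * E + 2] used for the axioms and the bound [c] on split
   coordinate spaces. *)
have EM : (3 * E + 2 <= 3 * E + 2 + c)%R by rewrite lerDl.
have [h1 h2 h3 [h4 h5 h6]] := densify_spec E0 hDE EM hnorm hwedges hclean.
exists (densify D (3 * E + 2 + c)); do 5 (split=> //); split=> //.
apply: (densify_nonsplit_orthogonals hDE _ hc hns).
by rewrite lerDr; lra.
Qed.
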